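(* Let $\alpha,\beta,\gamma\in\mathbb{R}$ and let $G_3$ be the connected, simply connected three-dimensional Lie group with left-invariant Lorentzian metric $g$ whose Lie algebra has a pseudo-orthonormal basis $\{\widetilde e_1,\widetilde e_2,\widetilde e_3\}$, with $\widetilde e_3$ timelike, satisfying $$[\widetilde e_1,\widetilde e_2]=-\gamma\widetilde e_3,\quad [\widetilde e_1,\widetilde e_3]=-\beta\widetilde e_2,\quad [\widetilde e_2,\widetilde e_3]=\alpha\widetilde e_1.$$ Let $\nabla^B$ be the Bott connection and $\widetilde\rho^B$ its symmetrized Ricci tensor. Then $(G_3,\nabla^B,\widetilde\rho^B)$ is a quasi-statistical structure.
   Context: Basis vectors are identified with left-invariant vector fields on the group $G$; $g(\widetilde e_1,\widetilde e_1)=g(\widetilde e_2,\widetilde e_2)=1$, $g(\widetilde e_3,\widetilde e_3)=-1$, and $g(\widetilde e_i,\widetilde e_j)=0$ for $i\ne j$. Let $\nabla^L$ be the Levi-Civita connection of $g$, $D=\mathrm{span}\{\widetilde e_1,\widetilde e_2\}$, $D^\perp=\mathrm{span}\{\widetilde e_3\}$ (distributions on $G$), with associated projections $\pi_D,\pi_{D^\perp}$ of $TG=D\oplus D^\perp$. The Bott connection $\nabla^B$ is the linear connection given by: $\nabla^B_XY=\pi_D(\nabla^L_XY)$ for $X,Y\in\Gamma^\infty(D)$; $\nabla^B_XY=\pi_D([X,Y])$ for $X\in\Gamma^\infty(D^\perp),Y\in\Gamma^\infty(D)$; $\nabla^B_XY=\pi_{D^\perp}([X,Y])$ for $X\in\Gamma^\infty(D),Y\in\Gamma^\infty(D^\perp)$;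 $\nabla^B_XY=\pi_{D^\perp}(\nabla^L_XY)$ for $X,Y\in\Gamma^\infty(D^\perp)$. Curvature: $R^B(X,Y)Z=\nabla^B_X\nabla^B_YZ-\nabla^B_Y\nabla^B_XZ-\nabla^B_{[X,Y]}Z$. Ricci tensor: $\rho^B(X,Y)=-g(R^B(X,\widetilde e_1)Y,\widetilde e_1)-g(R^B(X,\widetilde e_2)Y,\widetilde e_2)+g(R^B(X,\widetilde e_3)Y,\widetilde e_3)$. Symmetrized Ricci tensor: $\widetilde\rho^B(X,Y)=\tfrac12(\rho^B(X,Y)+\rho^B(Y,X))$. For a linear connection $\nabla$ with torsion $T(X,Y)=\nabla_XY-\nabla_YX-[X,Y]$ and a $(0,2)$ tensor field $\omega$, put $(\nabla_X\omega)(Y,Z)=X[\omega(Y,Z)]-\omega(\nabla_XY,Z)-\omega(Y,\nabla_XZ)$. The triple $(G,\nabla,\omega)$ is called a quasi-statistical structure if $(\nabla_X\omega)(Y,Z)-(\nabla_Y\omega)(X,Z)+\omega(T(X,Y),Z)=0$ for all vector fields $X,Y,Z$. *)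

(* Defs.v *)
From HB Require Import structures.
From mathcomp Require Import all_boot all_order all_algebra.
From mathcomp Require Import all_classical all_reals all_analysis.

Set Implicit Arguments.
Unset Strict Implicit.
Unset Printing Implicit Defensive.

Import Order.TTheory GRing.Theory Num.Theory numFieldNormedType.Exports.

Local Open Scope classical_set_scope.
Local Open Scope ring_scope.

(* C^oo on an open set U, meaningless if U is not open: in finite dimension a
   function whose iterated directional derivatives are all Frechet
   differentiable on U has continuous derivatives of every order. *)
Fixpoint Ck_on (R : realType) (V W : normedModType R) (k : nat)
    (U : set V) (f : V -> W) : Prop :=
  match k with
  | 0 => forall x, U x -> {for x, continuous f}
  | k'.+1 => (forall x, U x -> differentiable f x) /\
             (forall v : V, Ck_on k' U (fun x => 'D_v f x))
  end.

Definition smooth_on (R : realType) (V W : normedModType R)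
    (U : set V) (f : V -> W) : Prop := forall k, Ck_on k U f.

Section Ck_theory.
Context {R : realType} {V : normedModType R}.
Implicit Types (U : set V).


Lemma differentiable_near (W : normedModType R) (f g : V -> W) x :
  (\forall y \near x, f y = g y) -> differentiable f x -> differentiable g x.
Proof.
move=> fg df; rewrite -[g](subrKC f); apply: differentiableD => //.
set h := g - f.
have h0 : \forall y \near x, h y = 0.
  by apply: filterS fg => y fgy; rewrite -[h y]/(g y - f y) fgy subrr.
have hx : h x = 0 by exact: nbhs_singleton h0.
have hE : h \o shift x = cst (h x) + (\0 : {linear V -> W}) +o_ 0 id.
  apply/eqaddoP => _/posnumP[e].
  have : \forall y \near 0, h (y + x) = 0.
    by move: h0; rewrite (near_shift 0) subr0.
  apply: filterS => y /= hy.
  by rewrite !fctE /= hy hx addr0 subrr normr0 mulr_ge0.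
have c0 : continuous (\0 : {linear V -> W}) by exact: cst_continuous.
have dE := diff_unique c0 hE.
by apply/diff_locallyP; rewrite dE; split.
Qed.

Lemma Ck_on_eq (W : normedModType R) k U (f g : V -> W) : open U ->
  (forall x, U x -> f x = g x) -> Ck_on k U f -> Ck_on k U g.
Proof.
move=> oU; elim: k f g => [|k IH] f g fg /=.
  move=> cf x Ux; have fx := fg _ Ux; rewrite /prop_for /continuous_at -fx.
  apply: cvg_trans (cf x Ux); apply: near_eq_cvg.
  by apply: filterS (open_nbhs_nbhs (conj oU Ux)) => y /fg.
have fgn x : U x -> \forall y \near x, f y = g y.
  by move=> Ux; apply: filterS (open_nbhs_nbhs (conj oU Ux)) => y /fg.
move=> [df Df]; split=> [x Ux|v]; first exact: differentiable_near (fgn x Ux) (df x Ux).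
by apply: IH (Df v) => x Ux; exact: near_eq_derive (fgn x Ux).
Qed.

Lemma Ck_onW (W : normedModType R) k U (f : V -> W) :
  Ck_on k.+1 U f -> Ck_on k U f.
Proof.
elim: k f => [|k IH] f; last by move=> [df Df]; split=> // v; exact/IH/Df.
by move=> [df _] x Ux; exact/differentiable_continuous/df.
Qed.

Lemma Ck_on_cst (W : normedModType R) k U (a : W) : Ck_on k U (fun=> a).
Proof.
elim: k a => [|k IH] a; first by move=> x _; exact: cst_continuous.
split=> [x _|v]; first exact: differentiable_cst.
by under eq_fun do rewrite derive_cst; exact: IH.
Qed.

Lemma Ck_onD (W : normedModType R) k U (f g : V -> W) : open U ->
  Ck_on k U f -> Ck_on k U g -> Ck_on k U (f + g).
Proof.
move=> oU; elim: k f g => [|k IH] f g.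
  by move=> cf cg x Ux; apply: continuousD; [exact: cf|exact: cg].
move=> [df Df] [dg Dg]; split=> [x Ux|v].
  by apply: differentiableD; [exact: df|exact: dg].
apply: Ck_on_eq (IH _ _ (Df v) (Dg v)) => // x Ux.
by rewrite deriveD//; apply: diff_derivable; [exact: df|exact: dg].
Qed.

Lemma Ck_onM k U (f g : V -> R) : open U ->
  Ck_on k U f -> Ck_on k U g -> Ck_on k U (f * g).
Proof.
move=> oU; elim: k f g => [|k IH] f g.
  by move=> cf cg x Ux; apply: continuousM; [exact: cf|exact: cg].
move=> Sf Sg; have [df Df] := Sf; have [dg Dg] := Sg; split=> [x Ux|v].
  by apply: differentiableM; [exact: df|exact: dg].
have := Ck_onD oU (IH _ _ (Ck_onW Sf) (Dg v)) (IH _ _ (Ck_onW Sg) (Df v)).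
apply: Ck_on_eq => // x Ux.
by rewrite deriveM//; apply: diff_derivable; [exact: df|exact: dg].
Qed.

End Ck_theory.

Record chart (R : realType) (E : normedModType R) (M : topologicalType) := Chart {
  chart_dom : set M;
  chart_cod : set E;
  coord : M -> E;
  param : E -> M;
  chart_dom_open : open chart_dom;
  chart_cod_open : open chart_cod;
  coord_cod : forall p, chart_dom p -> chart_cod (coord p);
  param_dom : forall x, chart_cod x -> chart_dom (param x);
  coordK : forall p, chart_dom p -> param (coord p) = p;
  paramK : forall x, chart_cod x -> coord (param x) = x;
  coord_continuous : forall p, chart_dom p -> {for p, continuous coord};
  param_continuous : forall x, chart_cod x -> {for x, continuous param} }.

(* The atlas is not required to be maximal: smooth functions, vector fields and
   maps only depend on the maximal atlas that it generates. *)
Definition smooth_manifold (R : realType) (E : normedModType R)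
    (M : topologicalType) (A : set (chart E M)) : Prop :=
  [/\ hausdorff_space M,
      @second_countable M,
      forall p, exists2 c, A c & chart_dom c p &
      forall c c', A c -> A c' ->
        smooth_on [set x | chart_cod c x /\ chart_dom c' (param c x)]
          (fun x => coord c' (param c x))].

Definition simply_connected (R : realType) (M : topologicalType) : Prop :=
  connected [set: M] /\
  forall l : R -> M, {within `[0, 1], continuous l} -> l 0 = l 1 ->
    exists H : R * R -> M,
      [/\ {within `[0, 1] `*` `[0, 1], continuous H},
          forall t : R, t \in `[0, 1] -> H (0, t) = l t /\ H (1, t) = l 0 &
          forall s : R, s \in `[0, 1] -> H (s, 0) = l 0 /\ H (s, 1) = l 0].

Section smooth_functions.
Context {R : realType} {E : normedModType R} {M : topologicalType}.
Variable A : set (chart E M).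

Definition smooth_fun : {pred M -> R} := fun f =>
  `[< forall c, A c -> smooth_on (chart_cod c) (f \o param c) >].

Record cinf := Cinf { cinf_fun :> M -> R; _ : cinf_fun \in smooth_fun }.

HB.instance Definition _ := [isSub for cinf_fun].
HB.instance Definition _ := [Choice of cinf by <:].

Lemma smooth_fun_subring_closed : subring_closed smooth_fun.
Proof.
have smM f g : f \in smooth_fun -> g \in smooth_fun -> f * g \in smooth_fun.
  move=> /asboolP sf /asboolP sg; apply/asboolP => c Ac k.
  exact: Ck_onM (chart_cod_open c) (sf c Ac k) (sg c Ac k).
have sm_cst (a : R) : (fun=> a) \in smooth_fun.
  by apply/asboolP => c _ k; exact: Ck_on_cst.
split=> [|f g sf sg|]; [exact: sm_cst| |exact: smM].
have /asboolP sNg := smM _ _ (sm_cst (-1)) sg; move/asboolP : sf => sf.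
have -> : f - g = f + (fun=> -1) * g.
  by apply/funext => p; rewrite -[LHS]/(f p - g p) -[RHS]/(f p + -1 * g p) mulN1r.
apply/asboolP => c Ac k.
exact: Ck_onD (chart_cod_open c) (sf c Ac k) (sNg c Ac k).
Qed.

HB.instance Definition _ :=
  GRing.isSubringClosed.Build _ smooth_fun smooth_fun_subring_closed.
HB.instance Definition _ :=
  GRing.SubChoice_isSubComPzRing.Build _ _ cinf smooth_fun_subring_closed.

Lemma smooth_fun_submod_closed : subsemimod_closed smooth_fun.
Proof.
split=> [|a f sf]; first by split; [exact: rpred0|exact: rpredD].
have -> : a *: f = (fun=> a) * f by [].
by rewrite rpredM//; apply/asboolP => c _ k; exact: Ck_on_cst.
Qed.

HB.instance Definition _ :=
  GRing.SubZmodule_isSubLmodule.Build R _ _ cinf smooth_fun_submod_closed.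

End smooth_functions.

(* Smooth sections of the tangent bundle are identified with the first-order
   differential operators that they induce on C^oo(M): a vector field is an
   operator X which in each chart c reads X = \sum_i a_i d_i with a smooth, i.e.
   acts as the derivative in the direction a.  The tangent vector of X at p is
   the functional f |-> X f p.  Only the values of operators (metrics,
   connections, projections) on vector fields are constrained or used. *)
Section vector_fields.
Context {R : realType} {E : normedModType R} {M : topologicalType}.
Context {A : set (chart E M)}.
Local Notation field := (cinf A -> cinf A).
Implicit Types (f : cinf A) (X Y Z : field) (nab w g : field -> field -> cinf A).

Definition vector_field X : Prop := forall c, A c ->
  exists2 a : E -> E, smooth_on (chart_cod c) a &
    forall f x, chart_cod c x -> X f (param c x) = 'D_(a x) (f \o param c) x.

Definition eq_at (p : M) X Y : Prop := forall f, X f p = Y f p.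

Definition fmul f X : field := fun h => f * X h.

Definition lie_bracket X Y : field := fun f => X (Y f) - Y (X f).

Definition tensor02 w : Prop :=
  [/\ forall f X Y Z, vector_field X -> vector_field Y -> vector_field Z ->
        w (fmul f X + Y) Z = f * w X Z + w Y Z,
      forall f X Y Z, vector_field X -> vector_field Y -> vector_field Z ->
        w X (fmul f Y + Z) = f * w X Y + w X Z &
      forall p X X' Y Y', vector_field X -> vector_field X' ->
        vector_field Y -> vector_field Y' ->
        eq_at p X X' -> eq_at p Y Y' -> w X Y p = w X' Y' p].

(* Nondegenerate of index 1: at each point there is a timelike vector on whose
   orthogonal complement g is positive definite. *)
Definition lorentzian_metric g : Prop :=
  [/\ tensor02 g,
      forall X Y, vector_field X -> vector_field Y -> g X Y = g Y X &
      forall p, exists T, [/\ vector_field T, g T T p < 0 &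
        forall Y, vector_field Y -> g T Y p = 0 -> ~ eq_at p Y 0 ->
          0 < g Y Y p]].

Definition linear_connection (nab : field -> field -> field) : Prop :=
  [/\ forall X Y, vector_field X -> vector_field Y -> vector_field (nab X Y),
      forall f X Y Z, vector_field X -> vector_field Y -> vector_field Z ->
        nab (fmul f X + Y) Z = fmul f (nab X Z) + nab Y Z,
      forall X Y Z, vector_field X -> vector_field Y -> vector_field Z ->
        nab X (Y + Z) = nab X Y + nab X Z &
      forall f X Y, vector_field X -> vector_field Y ->
        nab X (fmul f Y) = fmul (X f) Y + fmul f (nab X Y)].

Definition torsion (nab : field -> field -> field) X Y : field :=
  nab X Y - nab Y X - lie_bracket X Y.

Definition curvature (nab : field -> field -> field) X Y Z : field :=
  nab X (nab Y Z) - nab Y (nab X Z) - nab (lie_bracket X Y) Z.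

Definition cov_derivative (nab : field -> field -> field) w X Y Z : cinf A :=
  X (w Y Z) - w (nab X Y) Z - w Y (nab X Z).

Definition levi_civita g (nab : field -> field -> field) : Prop :=
  [/\ linear_connection nab,
      forall X Y, vector_field X -> vector_field Y -> torsion nab X Y = 0 &
      forall X Y Z, vector_field X -> vector_field Y -> vector_field Z ->
        cov_derivative nab g X Y Z = 0].

(* The smooth sections of the distribution spanned by the fields in s. *)
Definition span_sections (s : seq field) : set field :=
  [set X | vector_field X /\
     forall p, exists a : nat -> R,
       forall f, X f p = \sum_(i < size s) a i * s`_i f p].

(* This determines piD and piD' when TM is the direct sum of D and D'. *)
Definition splitting (D D' : set field) (piD piD' : field -> field) : Prop :=
  forall X, vector_field X -> [/\ D (piD X), D' (piD' X) & X = piD X + piD' X].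

Definition bott_connection (D D' : set field) (piD piD' : field -> field)
    (nabL nabB : field -> field -> field) : Prop :=
  linear_connection nabB /\
  [/\ forall X Y, D X -> D Y -> nabB X Y = piD (nabL X Y),
      forall X Y, D' X -> D Y -> nabB X Y = piD (lie_bracket X Y),
      forall X Y, D X -> D' Y -> nabB X Y = piD' (lie_bracket X Y) &
      forall X Y, D' X -> D' Y -> nabB X Y = piD' (nabL X Y)].

Definition ricci g (e1 e2 e3 : field) (nab : field -> field -> field) X Y
    : cinf A :=
  - g (curvature nab X e1 Y) e1 - g (curvature nab X e2 Y) e2
  + g (curvature nab X e3 Y) e3.

Definition sym_ricci g (e1 e2 e3 : field) (nab : field -> field -> field) X Y
    : cinf A :=
  (2^-1 : R) *: (ricci g e1 e2 e3 nab X Y + ricci g e1 e2 e3 nab Y X).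

Definition quasi_statistical (nab : field -> field -> field) w : Prop :=
  [/\ linear_connection nab, tensor02 w &
      forall X Y Z, vector_field X -> vector_field Y -> vector_field Z ->
        cov_derivative nab w X Y Z - cov_derivative nab w Y X Z
        + w (torsion nab X Y) Z = 0].

Definition pseudo_orthonormal g (e1 e2 e3 : field) : Prop :=
  [/\ g e1 e1 = 1, g e2 e2 = 1 & g e3 e3 = -1] /\
  [/\ g e1 e2 = 0, g e1 e3 = 0, g e2 e1 = 0 &
      [/\ g e2 e3 = 0, g e3 e1 = 0 & g e3 e2 = 0]].

End vector_fields.

#[short(type="groupTopologicalType")]
HB.structure Definition GroupTopological := {G of Group G & Topological G}.

Record lieGroup (R : realType) (E : normedModType R) := LieGroup {
  lie_carrier :> groupTopologicalType;
  lie_atlas : set (chart E lie_carrier);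
  lie_manifold : smooth_manifold lie_atlas;
  lie_mul_continuous :
    continuous (fun xy : lie_carrier * lie_carrier => (xy.1 * xy.2)%g);
  lie_mul_smooth : forall c1 c2 c : chart E lie_carrier,
    lie_atlas c1 -> lie_atlas c2 -> lie_atlas c ->
    smooth_on
      [set xy : E * E | [/\ chart_cod c1 xy.1, chart_cod c2 xy.2 &
                            chart_dom c (param c1 xy.1 * param c2 xy.2)%g]]
      (fun xy => coord c (param c1 xy.1 * param c2 xy.2)%g);
  lie_inv_continuous : continuous (fun x : lie_carrier => (x^-1)%g);
  lie_inv_smooth : forall c1 c : chart E lie_carrier,
    lie_atlas c1 -> lie_atlas c ->
    smooth_on [set x | chart_cod c1 x /\ chart_dom c (param c1 x)^-1%g]
      (fun x => coord c (param c1 x)^-1%g) }.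

Arguments lie_atlas {R E} l.

Section left_invariance.
Context {R : realType} {E : normedModType R} {G : lieGroup E}.
Local Notation field := (cinf (lie_atlas G) -> cinf (lie_atlas G)).
Implicit Types (X Y : field) (a : G).

(* Y is the push-forward of X along the left translation L_a, that is
   X (h \o L_a) = (Y h) \o L_a; here f stands for h \o L_a. *)
Definition left_related a X Y : Prop :=
  forall f h : cinf (lie_atlas G), (forall x : G, f x = h (a * x)%g) ->
    forall x : G, X f x = Y h (a * x)%g.

Definition left_invariant : set field :=
  [set X | vector_field X /\ forall a, left_related a X X].

Definition left_invariant_metric (g : field -> field -> cinf (lie_atlas G)) :=
  lorentzian_metric g /\
  forall a X X' Y Y', vector_field X -> vector_field X' ->
    vector_field Y -> vector_field Y' ->
    left_related a X X' -> left_related a Y Y' ->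
    forall x : G, g X Y x = g X' Y' (a * x)%g.

Definition lie_algebra_basis (e1 e2 e3 : field) : Prop :=
  [/\ left_invariant e1, left_invariant e2, left_invariant e3 &
      forall X, left_invariant X ->
        exists! a : R * R * R, X = a.1.1 *: e1 + a.1.2 *: e2 + a.2 *: e3].

End left_invariance.

(* Main.v *)
Require Import Defs.
From HB Require Import structures.
From mathcomp Require Import all_boot all_order all_algebra.
From mathcomp Require Import all_classical all_reals all_analysis.
From mathcomp Require Import ring lra.

(** Write x_i for the components of a vector field X in the frame e_1, e_2, e_3.
The brackets give the structure equations of the dual coframe, and everything
about the Bott connection can be read off its matrix in this frame.

[e_1, e_2] is orthogonal to D = span(e_1, e_2), so by the Koszul formula
nabla^L_{e_i} e_j has no component in D for i, j = 1, 2.  The mixed derivatives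
are projected brackets, hence the only nonzero derivatives of frame fields are
nabla_{e_3} e_1 = beta e_2 and nabla_{e_3} e_2 = - alpha e_1 (bott_frame).  In other words
nabla_X = X + x_3 K on components (bottE), with K the constant endomorphism
e_1 |-> beta e_2, e_2 |-> - alpha e_1, e_3 |-> 0.  The connection form is the
1-form x_3 times one fixed matrix, so there is no quadratic term in the
curvature, which is the exterior derivative of x_3 times K:
R(X, Y) = gamma (x_1 y_2 - x_2 y_1) K (bott_curvature).

Tracing, the Ricci tensor is the constant diagonal form
omega(X, Y) = - gamma (beta x_1 y_1 + alpha x_2 y_2) (bott_ricci), which is
already symmetric.  K is skew for omega: the terms in omega(K e_1, e_2) and
omega(e_1, K e_2) are - gamma alpha beta and + gamma alpha beta.  A constant
form for which the connection matrix is skew is parallel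
(bott_parallel_sym_ricci).

Finally the torsion is T(X, Y) = gamma (x_1 y_2 - x_2 y_1) e_3 (bott_torsion),
and e_3 lies in the kernel of omega.  Hence the three terms of the
quasi-statistical identity vanish separately. *)

Set Implicit Arguments.
Unset Strict Implicit.
Unset Printing Implicit Defensive.

Import Order.TTheory GRing.Theory Num.Theory numFieldNormedType.Exports.

Local Open Scope classical_set_scope.
Local Open Scope ring_scope.

(** * Products of scalar and vector-valued smooth maps *)

Section scale_smooth.
Context {R : realType} {V W : normedModType R}.
Implicit Types (k : V -> R) (a : V -> W) (U : set V).

Let scale_is_bilinear :
  bilinear_for
    (GRing.Scale.Law.clone _ _ *:%R _) (GRing.Scale.Law.clone _ _ *:%R _)
    ( *:%R : R -> W -> W).
Proof.
split=> [w|r] b x y /=; first by rewrite scalerDl scalerA.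
by rewrite scalerDr !scalerA mulrC.
Qed.

Let scaleB := bilinear_isBilinear.Build R R W W _ _ ( *:%R : R -> W -> W)
  scale_is_bilinear.

(** The scalar-vector version of the product rule, obtained by composing the
bilinear map ( *:%R ) with the pair (k, a). *)
Lemma is_diff_scale k a x : differentiable k x -> differentiable a x ->
  is_diff x (fun z => k z *: a z) (fun v => k x *: 'd a x v + 'd k x v *: a x).
Proof.
pose s : {bilinear R -> W -> W} := HB.pack ( *:%R : R -> W -> W) scaleB.
move=> dk da; have cs : continuous (fun p : R * W => s p.1 p.2).
  by move=> [r w]; exact: scale_continuous.
have dp : differentiable (fun y => (k y, a y)) x by exact: differentiable_pair.
have ds := differentiable_bilin (k x, a x) cs.
rewrite -[fun z => _]/((fun p => s p.1 p.2) \o (fun y => (k y, a y))).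
apply: DiffDef; first exact: differentiable_comp.
apply/funext => v.
by rewrite (diff_comp dp ds) /= (diff_bilin (k x, a x) cs) (diff_pair dk da).
Qed.

Lemma differentiable_scale k a x : differentiable k x -> differentiable a x ->
  differentiable (fun z => k z *: a z) x.
Proof. by move=> dk da; have [] := is_diff_scale dk da. Qed.

Lemma derive_scale k a x v : differentiable k x -> differentiable a x ->
  'D_v (fun z => k z *: a z) x = k x *: 'D_v a x + 'D_v k x *: a x.
Proof.
move=> dk da; have [dka dE] := is_diff_scale dk da.
by rewrite !deriveE// dE.
Qed.

(** The components of f X in a chart are products of this form, so this is what
makes vector fields a module over the smooth functions. *)
Lemma Ck_on_scale n U k a : open U ->
  Ck_on n U k -> Ck_on n U a -> Ck_on n U (fun z => k z *: a z).
Proof.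
move=> oU; elim: n k a => [|n IH] k a.
  by move=> ck ca x Ux; apply: continuousZ; [exact: ck|exact: ca].
move=> Sk Sa; have [dk Dk] := Sk; have [da Da] := Sa; split=> [x Ux|v].
  by apply: differentiable_scale; [exact: dk|exact: da].
have := Ck_onD oU (IH _ _ (Ck_onW Sk) (Da v)) (IH _ _ (Dk v) (Ck_onW Sa)).
by apply: Ck_on_eq => // x Ux; rewrite derive_scale//; [exact: dk|exact: da].
Qed.

End scale_smooth.

(** * Vector fields as derivations *)

Section vector_field_calculus.
Context {R : realType} {E : normedModType R} {M : topologicalType}.
Context {A : set (chart E M)}.
Local Notation field := (cinf A -> cinf A).
Implicit Types (f h : cinf A) (X Y Z : field).

Lemma cinfP f h : (forall p, f p = h p) -> f = h.
Proof. by move=> fh; apply/val_inj/funext. Qed.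

Lemma cinfD f h p : (f + h) p = f p + h p.   Proof. by []. Qed.
Lemma cinfN f p : (- f) p = - f p.           Proof. by []. Qed.
Lemma cinfM f h p : (f * h) p = f p * h p.   Proof. by []. Qed.
Lemma cinfZ (a : R) f p : (a *: f) p = a * f p.  Proof. by []. Qed.
Lemma cinf0 p : (0 : cinf A) p = 0.  Proof. by []. Qed.
Lemma cinf1 p : (1 : cinf A) p = 1.  Proof. by []. Qed.
Definition cinfE := (cinfD, cinfN, cinfM, cinfZ, cinf0, cinf1).

Lemma cinf_differentiable f c x : A c -> chart_cod c x ->
  differentiable (f \o param c) x.
Proof.
by move=> Ac cx; have /asboolP/(_ c Ac 1%N) [] := valP f => + _; apply.
Qed.

Lemma vector_field0 : vector_field (0 : field).
Proof.
move=> c Ac; exists (fun=> 0); first by move=> k; exact: Ck_on_cst.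
move=> f x cx; rewrite deriveE ?linear0//; exact: cinf_differentiable.
Qed.

Lemma vector_field_fmulD f X Y : vector_field X -> vector_field Y ->
  vector_field (fmul f X + Y).
Proof.
move=> vX vY c Ac; have [a sa aE] := vX c Ac; have [b sb bE] := vY c Ac.
exists (fun x => f (param c x) *: a x + b x).
  move=> k; apply: Ck_onD (sb k); first exact: chart_cod_open.
  apply: Ck_on_scale (sa k); first exact: chart_cod_open.
  by have /asboolP := valP f; exact.
move=> h x cx; rewrite !cinfE aE// bE//.
have dh := cinf_differentiable h Ac cx.
by rewrite !deriveE// linearD linearZ.
Qed.

Lemma vector_fieldM f X : vector_field X -> vector_field (fmul f X).
Proof.
move=> vX; rewrite -[fmul f X]addr0; exact: vector_field_fmulD vector_field0.
Qed.

Section derivation.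
Hypothesis cover : forall p : M, exists2 c, A c & chart_dom c p.
Variable X : field.
Hypothesis vX : vector_field X.

(** A vector field at a point is a directional derivative in a chart; the
derivation rules below are inherited from it. *)
Lemma vector_field_in_chart p : exists c x v,
  [/\ p = param c x, A c, chart_cod c x &
      forall f, X f p = 'D_v (f \o param c) x].
Proof.
have [c Ac cp] := cover p; have [a _ aE] := vX Ac.
exists c, (Defs.coord c p), (a (Defs.coord c p)); have cx := coord_cod cp.
by split=> // [|f]; rewrite ?coordK// -aE// coordK.
Qed.

Lemma vector_fieldD f h : X (f + h) = X f + X h.
Proof.
apply: cinfP => p; have [c [x [v [-> Ac cx XE]]]] := vector_field_in_chart p.
rewrite cinfE !XE -deriveD//; exact/diff_derivable/cinf_differentiable.
Qed.

Lemma vector_field_leibniz f h : X (f * h) = f * X h + h * X f.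
Proof.
apply: cinfP => p; have [c [x [v [-> Ac cx XE]]]] := vector_field_in_chart p.
rewrite !cinfE !XE -deriveM//; exact/diff_derivable/cinf_differentiable.
Qed.

Lemma vector_fieldZ (a : R) f : X (a *: f) = a *: X f.
Proof.
apply: cinfP => p; have [c [x [v [-> Ac cx XE]]]] := vector_field_in_chart p.
rewrite cinfZ !XE -[RHS](@deriveZ _ _ _ (f \o param c) a)//.
exact/diff_derivable/cinf_differentiable.
Qed.

Lemma vector_field_cst (a : R) : X (a *: (1 : cinf A)) = 0.
Proof.
rewrite vector_fieldZ; have := vector_field_leibniz 1 1.
by rewrite !mul1r -[LHS]addr0 => /addrI <-; rewrite scaler0.
Qed.

End derivation.

End vector_field_calculus.

(** * Linearity of tensors and connections over smooth functions *)

Section tensorial_calculus.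
Context {R : realType} {E : normedModType R} {M : topologicalType}.
Context {A : set (chart E M)}.
Local Notation field := (cinf A -> cinf A).
Implicit Types (f h : cinf A) (X Y Z : field).

Lemma fieldP X Y : (forall f p, X f p = Y f p) -> X = Y.
Proof. by move=> XY; apply/funext => f; apply: cinfP => p. Qed.

Lemma fieldDE X Y f : (X + Y) f = X f + Y f.   Proof. by []. Qed.
Lemma fieldNE X f : (- X) f = - X f.   Proof. by []. Qed.
Lemma fieldZE (a : R) X f : (a *: X) f = a *: X f.   Proof. by []. Qed.
Lemma fmulE h X f : fmul h X f = h * X f.   Proof. by []. Qed.
Lemma field0E f : (0 : field) f = 0.   Proof. by []. Qed.
Definition fieldE := (fieldDE, fieldNE, fieldZE, fmulE, field0E, @cinfE R E M A).

Section tensor.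
Variable w : field -> field -> cinf A.
Hypothesis wT : tensor02 w.

Lemma tensorDl X Y Z : vector_field X -> vector_field Y -> vector_field Z ->
  w (X + Y) Z = w X Z + w Y Z.
Proof.
move=> vX vY vZ; have [/(_ 1 X Y Z vX vY vZ) + _ _] := wT.
rewrite mul1r => <-; congr (w (_ + _) _).
by apply: fieldP => f p; rewrite !fieldE mul1r.
Qed.

Lemma tensor0l Z : vector_field Z -> w 0 Z = 0.
Proof.
move=> vZ; have := tensorDl (@vector_field0 _ _ _ A) (@vector_field0 _ _ _ A) vZ.
by rewrite addr0 -[LHS]addr0 => /addrI <-.
Qed.

Lemma tensorMl f X Z : vector_field X -> vector_field Z ->
  w (fmul f X) Z = f * w X Z.
Proof.
move=> vX vZ; have v0 := @vector_field0 _ _ _ A; have [wl _ _] := wT.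
by rewrite -[fmul f X]addr0 wl// tensor0l// addr0.
Qed.

Lemma tensor_eq_at p X Y Z : vector_field X -> vector_field Y ->
  vector_field Z -> eq_at p X Y -> w X Z p = w Y Z p.
Proof. by move=> vX vY vZ XY; have [_ _ /(_ p X Y Z Z)->] := wT. Qed.

End tensor.

Section connection.
Variable nab : field -> field -> field.
Hypothesis nabP : linear_connection nab.

Lemma connectionDl X Y Z : vector_field X -> vector_field Y -> vector_field Z ->
  nab (X + Y) Z = nab X Z + nab Y Z.
Proof.
move=> vX vY vZ; have [_ /(_ 1 X Y Z vX vY vZ) + _ _] := nabP.
have fmul1 (U : field) : fmul 1 U = U by apply: fieldP => f p; rewrite !fieldE mul1r.
by rewrite !fmul1.
Qed.

Lemma connectionMl f X Z : vector_field X -> vector_field Z ->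
  nab (fmul f X) Z = fmul f (nab X Z).
Proof.
have v0 : vector_field (0 : field) by exact: vector_field0.
move=> vX vZ; have [_ nl _ _] := nabP; rewrite -[fmul f X]addr0 nl//.
have := connectionDl v0 v0 vZ.
by rewrite addr0 -[LHS]addr0 => /addrI <-; rewrite addr0.
Qed.

End connection.
End tensorial_calculus.

(** * Components in a pseudo-orthonormal frame *)

Section lorentzian_frame.
Context {R : realType} {E : normedModType R} {M : topologicalType}.
Context {A : set (chart E M)}.
Local Notation field := (cinf A -> cinf A).
Implicit Types (f h : cinf A) (X Y Z : field).
Hypothesis cover : forall p : M, exists2 c, A c & chart_dom c p.
Variables (g : field -> field -> cinf A) (e1 e2 e3 : field).
Hypothesis gT : tensor02 g.
Hypothesis ge : pseudo_orthonormal g e1 e2 e3.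
Hypotheses (v1 : vector_field e1) (v2 : vector_field e2) (v3 : vector_field e3).

(* The components of X: the sign of the third one comes from g e3 e3 = -1. *)
Local Notation co1 X := (g X e1).
Local Notation co2 X := (g X e2).
Local Notation co3 X := (- g X e3).
Local Notation const r := (r *: (1 : cinf A)).

Definition frame_comb a b c : field := fmul a e1 + (fmul b e2 + fmul c e3).

Lemma frame_combE a b c f p :
  frame_comb a b c f p = a p * e1 f p + b p * e2 f p + c p * e3 f p.
Proof. by rewrite /frame_comb !fieldE addrA. Qed.

Lemma vector_field_comb a b c : vector_field (frame_comb a b c).
Proof.
apply: vector_field_fmulD => //; apply: vector_field_fmulD => //.
exact: vector_fieldM.
Qed.

Let frame_coords a b c (X := frame_comb a b c) :
  [/\ co1 X = a, co2 X = b & co3 X = c].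
Proof.
have [[g11 g22 g33] [g12 g13 g21 [g23 g31 g32]]] := ge.
have vc : vector_field (fmul c e3) by exact: vector_fieldM.
have vbc : vector_field (fmul b e2 + fmul c e3) by exact: vector_field_fmulD.
have [gl _ _] := gT.
rewrite /X /frame_comb; split; rewrite !gl// !tensorMl//
  ?(g11, g22, g33, g12, g13, g21, g23) ?(g31, g32); ring.
Qed.

Lemma frame_coord1 a b c : co1 (frame_comb a b c) = a.
Proof. by have [] := frame_coords a b c. Qed.

Lemma frame_coord2 a b c : co2 (frame_comb a b c) = b.
Proof. by have [] := frame_coords a b c. Qed.

Lemma frame_coord3 a b c : co3 (frame_comb a b c) = c.
Proof. by have [] := frame_coords a b c. Qed.

(** Pointwise coefficients carry no smoothness of their own; since g is
tensorial, they are the values of the smooth components of X. *)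
Lemma coords_at p X (a b c : R) : vector_field X ->
  (forall f, X f p = a * e1 f p + b * e2 f p + c * e3 f p) ->
  [/\ co1 X p = a, co2 X p = b & co3 X p = c].
Proof.
move=> vX XE; pose k r : cinf A := r *: (1 : cinf A).
have vY := vector_field_comb (k a) (k b) (k c).
have XY : eq_at p X (frame_comb (k a) (k b) (k c)).
  by move=> f; rewrite XE frame_combE !cinfE; ring.
rewrite !cinfE !(tensor_eq_at gT vX vY _ XY)// -cinfN.
by rewrite frame_coord1 frame_coord2 frame_coord3 !cinfE !mulr1.
Qed.

Hypothesis frame_span : forall X, vector_field X ->
  span_sections [:: e1; e2; e3] X.

Lemma frame_expansion X : vector_field X ->
  X = frame_comb (co1 X) (co2 X) (co3 X).
Proof.
move=> vX; apply: fieldP => f p; have [_ /(_ p) [a XE]] := frame_span vX.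
have {}XE h : X h p = a 0%N * e1 h p + a 1%N * e2 h p + a 2%N * e3 h p.
  by rewrite XE !big_ord_recl big_ord0 /= addr0 addrA.
have [c1 c2 c3] := coords_at vX XE.
by rewrite frame_combE c1 c2 c3.
Qed.

Hypothesis gC : forall X Y, vector_field X -> vector_field Y -> g X Y = g Y X.

(** * Structure equations *)

Variables alpha beta gamma : R.
Hypothesis bracket12 : lie_bracket e1 e2 = - gamma *: e3.
Hypothesis bracket13 : lie_bracket e1 e3 = - beta *: e2.
Hypothesis bracket23 : lie_bracket e2 e3 = alpha *: e1.

(** The third line is the structure equation d theta_3 = gamma theta_1 /\ theta_2
of the dual coframe, evaluated on (X, Y); it produces both the curvature and the
torsion of the Bott connection. *)
Lemma lie_bracket_coords X Y : vector_field X -> vector_field Y ->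
  lie_bracket X Y = frame_comb
    (X (co1 Y) - Y (co1 X) + alpha *: (co2 X * co3 Y - co3 X * co2 Y))
    (X (co2 Y) - Y (co2 X) - beta *: (co1 X * co3 Y - co3 X * co1 Y))
    (X (co3 Y) - Y (co3 X) - gamma *: (co1 X * co2 Y - co2 X * co1 Y)).
Proof.
move=> vX vY; have XE := frame_expansion vX; have YE := frame_expansion vY.
(* From here on the components are arbitrary smooth functions; in particular
   co3 is no longer visible as an opposite. *)
move: (co1 X) (co2 X) (co3 X) (co1 Y) (co2 Y) (co3 Y) XE YE.
move=> x1 x2 x3 y1 y2 y3 XE YE; apply: fieldP => f p.
have b12 : e1 (e2 f) p = - gamma * e3 f p + e2 (e1 f) p.
  by apply/eqP; rewrite -subr_eq -[- gamma * _]/((- gamma *: e3) f p) -bracket12.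
have b13 : e1 (e3 f) p = - beta * e2 f p + e3 (e1 f) p.
  by apply/eqP; rewrite -subr_eq -[- beta * _]/((- beta *: e2) f p) -bracket13.
have b23 : e2 (e3 f) p = alpha * e1 f p + e3 (e2 f) p.
  by apply/eqP; rewrite -subr_eq -[alpha * _]/((alpha *: e1) f p) -bracket23.
have app U V a b c : vector_field U -> V = frame_comb a b c ->
    U (V f) p = U a p * e1 f p + U b p * e2 f p + U c p * e3 f p
      + a p * U (e1 f) p + b p * U (e2 f) p + c p * U (e3 f) p.
  move=> vU ->; have UD := vector_fieldD cover vU.
  have UM := vector_field_leibniz cover vU.
  rewrite -[frame_comb a b c f]/(a * e1 f + (b * e2 f + c * e3 f)).
  rewrite (UD (a * e1 f)) (UD (b * e2 f)) (UM a) (UM b) (UM c) !cinfE; ring.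
have at_p U h a b c : U = frame_comb a b c ->
    U h p = a p * e1 h p + b p * e2 h p + c p * e3 h p.
  by move=> ->; exact: frame_combE.
(* The second derivatives of f cancel except for the commutators of the frame. *)
rewrite -[LHS]/(X (Y f) p - Y (X f) p) (app X _ _ _ _ vX YE) (app Y _ _ _ _ vY XE).
rewrite !(at_p X (e1 f) _ _ _ XE) !(at_p X (e2 f) _ _ _ XE).
rewrite !(at_p X (e3 f) _ _ _ XE) !(at_p Y (e1 f) _ _ _ YE).
rewrite !(at_p Y (e2 f) _ _ _ YE) !(at_p Y (e3 f) _ _ _ YE).
by rewrite frame_combE !cinfE b12 b13 b23; ring.
Qed.

(** * The Levi-Civita connection along a pair of orthogonal fields *)

Lemma levi_civita_constant nab X Y Z (a : R) : levi_civita g nab ->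
  vector_field X -> vector_field Y -> vector_field Z ->
  g Y Z = a *: (1 : cinf A) -> g (nab X Y) Z = - g (nab X Z) Y.
Proof.
move=> [[vn _ _ _] _ /(_ X Y Z)] + vX vY vZ YZ; rewrite /cov_derivative YZ.
rewrite (vector_field_cst cover)// sub0r => /(_ vX vY vZ)/eqP.
rewrite (gC vY (vn _ _ vX vZ)) subr_eq0 => /eqP <-.
by rewrite opprK.
Qed.

Lemma levi_civita_unit nab X Y (a : R) : levi_civita g nab ->
  vector_field X -> vector_field Y -> g Y Y = a *: (1 : cinf A) ->
  g (nab X Y) Y = 0.
Proof.
move=> nabP vX vY /(levi_civita_constant nabP vX vY vY) gE.
apply: cinfP => p; have := congr1 (fun f : cinf A => f p) gE.
by rewrite !cinfE; lra.
Qed.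

(** The part of the Koszul formula used here: for orthogonal fields of constant
length, nab Y Z differs from nab Z Y by the bracket, here orthogonal to Y, and the
Y-component of nab Z Y vanishes because Y has constant length. *)
Lemma levi_civita_pair nab Y Z (a b : R) : levi_civita g nab ->
  vector_field Y -> vector_field Z ->
  g Y Y = a *: (1 : cinf A) -> g Z Z = b *: (1 : cinf A) -> g Y Z = 0 ->
  g (lie_bracket Y Z) Y = 0 -> vector_field (lie_bracket Y Z) ->
  [/\ g (nab Y Y) Y = 0, g (nab Y Y) Z = 0,
      g (nab Y Z) Y = 0 & g (nab Y Z) Z = 0].
Proof.
move=> nabP vY vZ gY gZ gYZ gb vb; have [[vn _ _ _] tf _] := nabP.
have nYZ : g (nab Y Z) Y = 0.
  have -> : nab Y Z = nab Z Y + lie_bracket Y Z.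
    apply/eqP; rewrite -subr_eq0 opprD addrA; apply/eqP; exact: tf.
  rewrite tensorDl//; last exact: vn.
  by rewrite gb (levi_civita_unit nabP vZ vY gY) addr0.
split=> //; [exact: levi_civita_unit gY| |exact: levi_civita_unit gZ].
by rewrite (@levi_civita_constant _ _ _ _ 0 nabP)// ?nYZ ?oppr0// gYZ scale0r.
Qed.

(** * The Bott connection and its torsion and curvature *)

Variables (piD piD' : field -> field) (nabL nabB : field -> field -> field).
Hypothesis piP : splitting (span_sections [:: e1; e2]) (span_sections [:: e3])
  piD piD'.
Hypothesis nabLP : levi_civita g nabL.
Hypothesis nabBP : bott_connection (span_sections [:: e1; e2])
  (span_sections [:: e3]) piD piD' nabL nabB.

(** The projections are determined by D + D' = TM because the components of a
section of either distribution along the other one vanish. *)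
Lemma splitting_proj X : vector_field X ->
  piD X = frame_comb (co1 X) (co2 X) 0 /\ piD' X = frame_comb 0 0 (co3 X).
Proof.
move=> vX; have [[vD DX] [vD' D'X] XE] := piP vX.
have D3 : co3 (piD X) = 0.
  apply: cinfP => p; have [a aE] := DX p.
  have [] // := @coords_at p (piD X) (a 0%N) (a 1%N) 0 vD.
  by move=> h; rewrite aE !big_ord_recl big_ord0 /=; ring.
have D'E p : co1 (piD' X) p = 0 /\ co2 (piD' X) p = 0.
  have [a aE] := D'X p.
  have [] // := @coords_at p (piD' X) 0 0 (a 0%N) vD'.
  by move=> h; rewrite aE !big_ord_recl big_ord0 /=; ring.
have D'1 : co1 (piD' X) = 0 by apply: cinfP => p; have [-> _] := D'E p.
have D'2 : co2 (piD' X) = 0 by apply: cinfP => p; have [_ ->] := D'E p.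
have add e : vector_field e -> g X e = g (piD X) e + g (piD' X) e.
  by move=> ve; rewrite {1}XE tensorDl.
rewrite {1}[piD X]frame_expansion// {1}[piD' X]frame_expansion//.
rewrite !add// D'1 D'2 D3; have /eqP := D3; rewrite oppr_eq0 => /eqP ->.
by rewrite !addr0 add0r.
Qed.

Lemma frame_comb0 : frame_comb 0 0 0 = 0.
Proof. by apply: fieldP => f p; rewrite frame_combE !cinfE; ring. Qed.

(** The connection matrix.  Within D the derivatives vanish since [e1, e2] is
orthogonal to D, within D' since e3 has constant length; across D and D' they
are projected brackets. *)
Lemma bott_frame :
  [/\ nabB e1 e1 = 0, nabB e1 e2 = 0, nabB e2 e1 = 0 & nabB e2 e2 = 0] /\
  [/\ nabB e1 e3 = 0, nabB e2 e3 = 0, nabB e3 e3 = 0,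
      nabB e3 e1 = beta *: e2 & nabB e3 e2 = - alpha *: e1].
Proof.
have [[g11 g22 g33] [g12 g13 g21 [g23 g31 g32]]] := ge.
have [[vL _ _ _] _ _] := nabLP.
have [_ [BDD BD'D BDD' BD'D']] := nabBP.
have D1 : span_sections [:: e1; e2] e1.
  split=> // p; exists (fun i => (i == 0%N)%:R) => f.
  by rewrite !big_ord_recl big_ord0 /=; ring.
have D2 : span_sections [:: e1; e2] e2.
  split=> // p; exists (fun i => (i == 1%N)%:R) => f.
  by rewrite !big_ord_recl big_ord0 /=; ring.
have D3 : span_sections [:: e3] e3.
  by split=> // p; exists (fun=> 1) => f; rewrite !big_ord_recl big_ord0 /=; ring.
have anti U V : lie_bracket U V = - lie_bracket V U :> field.
  by apply: fieldP => f p; rewrite /lie_bracket !fieldE opprB.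
have b12 : lie_bracket e1 e2 = frame_comb 0 0 (const (- gamma)).
  by rewrite bracket12; apply: fieldP => f p; rewrite frame_combE !fieldE; ring.
have b21 : lie_bracket e2 e1 = frame_comb 0 0 (const gamma).
  by rewrite anti bracket12; apply: fieldP => f p; rewrite frame_combE !fieldE; ring.
have b13 : lie_bracket e1 e3 = frame_comb 0 (const (- beta)) 0.
  by rewrite bracket13; apply: fieldP => f p; rewrite frame_combE !fieldE; ring.
have b23 : lie_bracket e2 e3 = frame_comb (const alpha) 0 0.
  by rewrite bracket23; apply: fieldP => f p; rewrite frame_combE !fieldE; ring.
have b31 : lie_bracket e3 e1 = frame_comb 0 (const beta) 0.
  by rewrite anti bracket13; apply: fieldP => f p; rewrite frame_combE !fieldE; ring.
have b32 : lie_bracket e3 e2 = frame_comb (const (- alpha)) 0 0.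
  by rewrite anti bracket23; apply: fieldP => f p; rewrite frame_combE !fieldE; ring.
have unit (e : field) : g e e = 1 -> g e e = (1 : R) *: (1 : cinf A).
  by rewrite scale1r.
have vc := vector_field_comb.
have [||L111 L112 L121 L122] :=
    @levi_civita_pair nabL e1 e2 1 1 nabLP v1 v2 (unit _ g11) (unit _ g22) g12.
  by rewrite b12 frame_coord1.
  by rewrite b12.
have [||L222 L221 L212 L211] :=
    @levi_civita_pair nabL e2 e1 1 1 nabLP v2 v1 (unit _ g22) (unit _ g11) g21.
  by rewrite b21 frame_coord2.
  by rewrite b21.
have pD0 X : vector_field X -> co1 X = 0 -> co2 X = 0 -> piD X = 0.
  by move=> vX X1 X2; have [-> _] := splitting_proj vX; rewrite X1 X2 frame_comb0.
have pD'0 X : vector_field X -> g X e3 = 0 -> piD' X = 0.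
  by move=> vX X3; have [_ ->] := splitting_proj vX; rewrite X3 oppr0 frame_comb0.
split; split.
- by rewrite BDD// pD0//; exact: vL.
- by rewrite BDD// pD0//; exact: vL.
- by rewrite BDD// pD0//; exact: vL.
- by rewrite BDD// pD0//; exact: vL.
- by rewrite BDD'// b13 pD'0//; apply/eqP; rewrite -oppr_eq0 frame_coord3.
- by rewrite BDD'// b23 pD'0//; apply/eqP; rewrite -oppr_eq0 frame_coord3.
- rewrite BD'D'// pD'0//; first exact: vL.
  by apply: (@levi_civita_unit _ _ _ (-1) nabLP); rewrite // g33 scaleN1r.
- rewrite BD'D// b31; have [-> _] := splitting_proj (vc 0 (const beta) 0).
  rewrite frame_coord1 frame_coord2.
  by apply: fieldP => f p; rewrite frame_combE !fieldE; ring.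
- rewrite BD'D// b32; have [-> _] := splitting_proj (vc (const (- alpha)) 0 0).
  rewrite frame_coord1 frame_coord2.
  by apply: fieldP => f p; rewrite frame_combE !fieldE; ring.
Qed.

(** nabla = d + theta_3 K, with K e1 = beta e2, K e2 = - alpha e1, K e3 = 0. *)
Lemma bott_comb X a b c : vector_field X ->
  nabB X (frame_comb a b c) = frame_comb
    (X a + - alpha *: (co3 X * b)) (X b + beta *: (co3 X * a)) (X c).
Proof.
move=> vX.
have [lin _] := nabBP; have [vB nl nD nM] := lin.
have [[n11 n12 n21 n22] [n13 n23 n33 n31 n32]] := bott_frame.
have vbc : vector_field (fmul b e2 + fmul c e3).
  by apply: vector_field_fmulD => //; exact: vector_fieldM.
have vMM f (e : field) : vector_field e -> vector_field (fmul f e).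
  exact: vector_fieldM.
have nX e : vector_field e -> nabB X e = fmul (co1 X) (nabB e1 e) +
    (fmul (co2 X) (nabB e2 e) + fmul (co3 X) (nabB e3 e)).
  move=> ve; rewrite {1}(frame_expansion vX) nl//.
    by rewrite nl//; [rewrite (connectionMl lin)|exact: vMM].
  by apply: vector_field_fmulD => //; exact: vMM.
rewrite {1}/frame_comb (nD X (fmul a e1) _ vX (vMM a e1 v1) vbc).
rewrite (nD X (fmul b e2) _ vX (vMM b e2 v2) (vMM c e3 v3)).
rewrite !nM// !nX// n11 n12 n13 n21 n22 n23 n31 n32 n33.
by apply: fieldP => f p; rewrite frame_combE !fieldE; ring.
Qed.

Lemma bottE X Y : vector_field X -> vector_field Y ->
  nabB X Y = frame_comb
    (X (co1 Y) + - alpha *: (co3 X * co2 Y))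
    (X (co2 Y) + beta *: (co3 X * co1 Y)) (X (co3 Y)).
Proof. by move=> vX vY; rewrite {1}(frame_expansion vY) bott_comb. Qed.

(** The terms of torsion in theta_3 and K cancel against the brackets with e3;
what is left is d theta_3. *)
Lemma bott_torsion X Y : vector_field X -> vector_field Y ->
  torsion nabB X Y =
    frame_comb 0 0 (gamma *: (co1 X * co2 Y - co2 X * co1 Y)).
Proof.
move=> vX vY; rewrite /torsion !bottE// lie_bracket_coords//.
(* This keeps the opposite inside co3 out of reach of the evaluation rules. *)
move: (co3 X) (co3 Y) => x3 y3; apply: fieldP => f p.
by rewrite !fieldDE !fieldNE !cinfD !cinfN !frame_combE !cinfE; ring.
Qed.

(** Since K is constant and the connection form is theta_3 K, the quadratic terms
commute and cancel: the curvature is d theta_3 K. *)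
Lemma bott_curvature X Y Z : vector_field X -> vector_field Y -> vector_field Z ->
  let w := co1 X * co2 Y - co2 X * co1 Y in
  curvature nabB X Y Z = frame_comb
    (- (gamma * alpha) *: (w * co2 Z)) (gamma * beta *: (w * co1 Z)) 0.
Proof.
move=> vX vY vZ /=; have bE := lie_bracket_coords vX vY.
have vb : vector_field (lie_bracket X Y).
  by rewrite bE; exact: vector_field_comb.
(* The only component of the bracket that the connection sees. *)
have b3 : co3 (lie_bracket X Y) = X (co3 Y) - Y (co3 X)
    - gamma *: (co1 X * co2 Y - co2 X * co1 Y).
  by rewrite {1}bE frame_coord3.
have step U V : vector_field U -> vector_field V ->
    nabB U (nabB V Z) = frame_comb
      (U (V (co1 Z)) + - alpha *: (co3 V * U (co2 Z) + co2 Z * U (co3 V))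
        + - alpha *: (co3 U * (V (co2 Z) + beta *: (co3 V * co1 Z))))
      (U (V (co2 Z)) + beta *: (co3 V * U (co1 Z) + co1 Z * U (co3 V))
        + beta *: (co3 U * (V (co1 Z) + - alpha *: (co3 V * co2 Z))))
      (U (V (co3 Z))).
  move=> vU vV; rewrite (bottE vV vZ) bott_comb//.
  rewrite (vector_fieldD cover vU (V (co1 Z))) (vector_fieldD cover vU (V (co2 Z))).
  by rewrite !(vector_fieldZ cover vU) !(vector_field_leibniz cover vU (co3 V)).
rewrite /curvature !step// (bottE vb vZ) b3.
move: (co1 Z) (co2 Z) (co3 Z) (co3 X) (co3 Y) => z1 z2 z3 x3 y3.
apply: fieldP => f p; rewrite !fieldDE !fieldNE !cinfD !cinfN !frame_combE.
by rewrite /lie_bracket !(cinfD, cinfN, cinfM, cinfZ, cinf0); ring.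
Qed.

(** * The Ricci tensor of the Bott connection *)

Lemma bott_ricci X Y : vector_field X -> vector_field Y ->
  ricci g e1 e2 e3 nabB X Y =
    - gamma *: (beta *: (co1 X * co1 Y) + alpha *: (co2 X * co2 Y)).
Proof.
move=> vX vY; have [[g11 g22 g33] [g12 g13 g21 [g23 g31 g32]]] := ge.
rewrite /ricci -[g (curvature _ _ e3 _) e3]opprK !bott_curvature//.
rewrite frame_coord1 frame_coord2 frame_coord3 g11 g12 g21 g22.
by apply: cinfP => p; rewrite !cinfE; ring.
Qed.

Lemma bott_sym_ricci X Y : vector_field X -> vector_field Y ->
  sym_ricci g e1 e2 e3 nabB X Y =
    - gamma *: (beta *: (co1 X * co1 Y) + alpha *: (co2 X * co2 Y)).
Proof.
move=> vX vY; rewrite /sym_ricci !bott_ricci//.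
by apply: cinfP => p; rewrite !cinfE; field.
Qed.

Lemma tensor02_sym_ricci : tensor02 (sym_ricci g e1 e2 e3 nabB).
Proof.
have [gl _ _] := gT; split.
- move=> f X Y Z vX vY vZ; have vXY := vector_field_fmulD f vX vY.
  rewrite !bott_sym_ricci// !gl//.
  by apply: cinfP => p; rewrite !cinfE; ring.
- move=> f X Y Z vX vY vZ; have vYZ := vector_field_fmulD f vY vZ.
  rewrite !bott_sym_ricci// !gl//.
  by apply: cinfP => p; rewrite !cinfE; ring.
move=> p X X' Y Y' vX vX' vY vY' XX' YY'; rewrite !bott_sym_ricci// !cinfE.
by rewrite !(tensor_eq_at gT vX vX' _ XX') // !(tensor_eq_at gT vY vY' _ YY').
Qed.

(** The endomorphism K of bott_comb is skew for the Ricci form, whose coefficients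
- gamma beta and - gamma alpha compensate those of K. *)
Lemma bott_parallel_sym_ricci X Y Z :
  vector_field X -> vector_field Y -> vector_field Z ->
  cov_derivative nabB (sym_ricci g e1 e2 e3 nabB) X Y Z = 0.
Proof.
move=> vX vY vZ; have [[vB _ _ _] _] := nabBP.
have vXY := vB _ _ vX vY; have vXZ := vB _ _ vX vZ.
have nco V : vector_field V ->
    co1 (nabB X V) = X (co1 V) + - alpha *: (co3 X * co2 V) /\
    co2 (nabB X V) = X (co2 V) + beta *: (co3 X * co1 V).
  by move=> vV; rewrite bottE// frame_coord1 frame_coord2.
rewrite /cov_derivative !bott_sym_ricci//.
have [-> ->] := nco _ vY; have [-> ->] := nco _ vZ.
rewrite (vector_fieldZ cover vX) (vector_fieldD cover vX (beta *: _)).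
rewrite !(vector_fieldZ cover vX) (vector_field_leibniz cover vX (co1 Y)).
rewrite (vector_field_leibniz cover vX (co2 Y)).
by apply: cinfP => p; rewrite !(cinfD, cinfN, cinfM, cinfZ, cinf0); ring.
Qed.

(** The torsion is a multiple of e3, which spans the kernel of the components
co1 and co2 that enter the Ricci form. *)
Lemma quasi_statistical_bott : quasi_statistical nabB (sym_ricci g e1 e2 e3 nabB).
Proof.
split; [by have [] := nabBP|exact: tensor02_sym_ricci|].
move=> X Y Z vX vY vZ; rewrite !bott_parallel_sym_ricci// bott_torsion//.
rewrite bott_sym_ricci//; last exact: vector_field_comb.
rewrite frame_coord1 frame_coord2.
by apply: cinfP => p; rewrite !(cinfD, cinfN, cinfM, cinfZ, cinf0); ring.
Qed.

End lorentzian_frame.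

Unset Implicit Arguments.

Theorem theorem3p4 (R : realType) (alpha beta gamma : R)
    (G3 : lieGroup 'rV[R]_3)
    (g : (cinf (lie_atlas G3) -> cinf (lie_atlas G3)) ->
         (cinf (lie_atlas G3) -> cinf (lie_atlas G3)) -> cinf (lie_atlas G3))
    (e1 e2 e3 : cinf (lie_atlas G3) -> cinf (lie_atlas G3))
    (piD piD' : (cinf (lie_atlas G3) -> cinf (lie_atlas G3)) ->
                (cinf (lie_atlas G3) -> cinf (lie_atlas G3)))
    (nabL nabB : (cinf (lie_atlas G3) -> cinf (lie_atlas G3)) ->
                 (cinf (lie_atlas G3) -> cinf (lie_atlas G3)) ->
                 (cinf (lie_atlas G3) -> cinf (lie_atlas G3)))
    (G3_connected : connected [set: G3])
    (G3_simply_connected : simply_connected R G3)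
    (g_metric : left_invariant_metric g)
    (e_basis : lie_algebra_basis e1 e2 e3)
    (e_orthonormal : pseudo_orthonormal g e1 e2 e3)
    (bracket12 : lie_bracket e1 e2 = - gamma *: e3)
    (bracket13 : lie_bracket e1 e3 = - beta *: e2)
    (bracket23 : lie_bracket e2 e3 = alpha *: e1)
    (nabL_levi_civita : levi_civita g nabL)
    (pi_splitting : splitting (span_sections [:: e1; e2])
                              (span_sections [:: e3]) piD piD')
    (nabB_bott : bott_connection (span_sections [:: e1; e2])
                   (span_sections [:: e3]) piD piD' nabL nabB) :
  quasi_statistical nabB (sym_ricci g e1 e2 e3 nabB).
Proof.
have [[gT gC _] _] := g_metric.
have [[v1 _] [v2 _] [v3 _] _] := e_basis.
have [_ _ cover _] := lie_manifold G3.
(* TM = D + D' makes the frame generate all vector fields. *)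
have frame_span X : vector_field X -> span_sections [:: e1; e2; e3] X.
  move=> vX; split=> // p; have [[_ DX] [_ D'X] XE] := pi_splitting _ vX.
  have [a aE] := DX p; have [b bE] := D'X p.
  exists (fun i => if i == 2%N then b 0%N else a i) => f.
  rewrite {1}XE fieldDE cinfD aE bE !big_ord_recl !big_ord0 /=; ring.
exact: (quasi_statistical_bott cover gT e_orthonormal v1 v2 v3 frame_span gC
  bracket12 bracket13 bracket23 pi_splitting nabL_levi_civita nabB_bott).
Qed.
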